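(* Let $p$ be a rational number. (i) If $p\in[0,1]$, then the hypograph of $f(X)=X^p$ (defined on positive semidefinite matrices), i.e. the set whose $n$-th section is $\{(X,Y)\in(\mathcal{S}^n_+)^2 : X^p\succeq Y\}$ for every $n\ge 1$, has a free semidefinite representation. (ii) If $p\in[1,2]$, then the epigraph of $f(X)=X^p$ (defined on positive semidefinite matrices), i.e. the set whose $n$-th section is $\{(X,Y)\in(\mathcal{S}^n_+)^2 : X^p\preceq Y\}$ for every $n\ge 1$, has a free semidefinite representation. (iii) If $p\in[-1,0]$, then the epigraph of $f(X)=X^p$ with domain restricted to positive definite matrices, i.e. the set whose $n$-th section is $\{(X,Y)\in\mathcal{S}^n_{++}\times\mathcal{S}^n_+ : X^p\preceq Y\}$ for every $n\ge 1$, has a free semidefinite representation.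
   Context: $\mathcal{S}^n$ is the space of real symmetric $n\times n$ matrices; $\mathcal{S}^n_+$ (resp. $\mathcal{S}^n_{++}$) is the cone of positive semidefinite (resp. positive definite) matrices in $\mathcal{S}^n$. $A\succeq B$ means $A-B$ is positive semidefinite, and $A \preceq B$ means $B\succeq A$. For $X=Q^T\Lambda Q$ an orthogonal spectral decomposition, $X^p:=Q^T\Lambda^pQ$; it is defined for $X\in\mathcal{S}^n_+$ if $p\ge 0$ (with $X^0=I$) and for $X\in\mathcal{S}^n_{++}$ for all real $p$. Linear pencil: given $\ell\ge1$, nonnegative integers $g,g'$ and $A=(A_0,\dots,A_{g+g'})\in(\mathcal{S}^\ell)^{g+g'+1}$, for every $n\ge 1$, $X\in(\mathcal{S}^n)^g$, $W\in(\mathcal{S}^n)^{g'}$ put $$L_A(X,W):=A_0\otimes I_n+\sum_{j=1}^gA_j\otimes X_j+\sum_{j=g+1}^{g+g'}A_j\otimes W_{j-g},$$ where $\otimes$ is the Kronecker product. A set $\mathcal{F}\subseteq\prod_{n=1}^\infty(\mathcal{S}^n)^g$ with $n$-th sections $\mathcal{F}|_n\subseteq(\mathcal{S}^n)^g$ (the set of $n$-th coordinates of elements of $\mathcal F$) has a free semidefinite representation if there exist $\ell$, $g'$ and one tuple $A\in(\mathcal{S}^\ell)^{g+g'+1}$, all independent of $n$, such that for all $n=1,2,\ldots$ $$\mathcal{F}|_n=\{X\in(\mathcal{S}^n)^g:\ \exists\, W\in(\mathcal{S}^n)^{g'},\ L_A(X,W)\succeq0\}.$$ Here this is applied with $g=2$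 to pairs $(X,Y)$. *)

(* Defs.v *)
From mathcomp Require Import all_boot all_order all_algebra.
From mathcomp Require Import mxtens.
From mathcomp Require Import all_classical all_reals all_analysis.

Set Implicit Arguments.
Unset Strict Implicit.
Unset Printing Implicit Defensive.

Import Order.TTheory GRing.Theory Num.Theory.

Local Open Scope classical_set_scope.
Local Open Scope ring_scope.

Definition psdmx (R : realType) (n : nat) (X : 'M[R]_n) : Prop :=
  X \is symmetricmx /\ forall v : 'cV[R]_n, 0 <= (v^T *m X *m v) 0 0.

Definition pdmx (R : realType) (n : nat) (X : 'M[R]_n) : Prop :=
  X \is symmetricmx /\
  forall v : 'cV[R]_n, v != 0 -> 0 < (v^T *m X *m v) 0 0.

Definition loewner_le (R : realType) (n : nat) (A B : 'M[R]_n) : Prop :=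
  psdmx (B - A).

Definition spectral_decomposition (R : realType) (n : nat) (X : 'M[R]_n)
    (Qd : 'M[R]_n * 'rV[R]_n) : Prop :=
  Qd.1^T *m Qd.1 = 1%:M /\ X = Qd.1^T *m diag_mx Qd.2 *m Qd.1.

(* Computed from an arbitrary spectral decomposition of [X]; the result does not
   depend on the chosen one, see [powmxE]. The default value (1, 0) is only
   reached when [X] is not symmetric. Real powers are those of [powR], for which
   0 `^ 0 = 1, hence [powmx X 0 = 1%:M]. *)
Definition powmx (R : realType) (n : nat) (X : 'M[R]_n) (p : R) : 'M[R]_n :=
  let Qd := xget (1%:M, 0) (spectral_decomposition X) in
  Qd.1^T *m diag_mx (map_mx (fun x => x `^ p) Qd.2) *m Qd.1.

Lemma powmxE (R : realType) (n : nat) (X : 'M[R]_n) (p : R)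
    (Q : 'M[R]_n) (d : 'rV[R]_n) :
  spectral_decomposition X (Q, d) ->
  powmx X p = Q^T *m diag_mx (map_mx (fun x => x `^ p) d) *m Q.
Proof.
move=> XQd; rewrite /powmx; have := xgetI (1%:M, 0) XQd.
case: (xget _ _) => Q' d' [/= Q'1 XQ'd'].
case: XQd => /= Q1 XQd.
have Q1' := mulmx1C Q1; have Q'1' := mulmx1C Q'1.
have [P PE] : exists P, P = Q *m Q'^T by exists (Q *m Q'^T).
have PD : P *m diag_mx d' = diag_mx d *m P.
  have : Q *m X *m Q'^T = Q *m X *m Q'^T by [].
  rewrite {1}XQ'd' XQd !mulmxA Q1' mul1mx -!mulmxA Q'1' mulmx1.
  by rewrite PE !mulmxA.
have PDp : P *m diag_mx (map_mx (fun x => x `^ p) d') =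
    diag_mx (map_mx (fun x => x `^ p) d) *m P.
  apply/matrixP => i j; move/matrixP: PD => /(_ i j).
  rewrite !mul_mx_diag !mul_diag_mx mxE [RHS]mxE => PDij.
  rewrite [LHS]mxE [RHS]mxE ![map_mx _ _ _ _]mxE.
  have [->|P0] := eqVneq (P i j) 0; first by rewrite mul0r mulr0.
  rewrite mulrC; congr (_ `^ p * _); apply: (mulfI P0).
  by rewrite PDij mulrC.
have -> : Q'^T = Q^T *m P by rewrite PE mulmxA Q1 mul1mx.
rewrite -[_ *m P *m _]mulmxA PDp -!mulmxA; congr (_ *m (_ *m _)).
by rewrite PE -mulmxA Q'1 mulmx1.
Qed.

(* [A] lists the coefficients A_0, A_1, ..., A_g, A_(g+1), ..., A_(g+g'). *)
Definition linear_pencil (R : realType) (l g g' n : nat)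
    (A : 'I_(g + g').+1 -> 'M[R]_l)
    (X : 'I_g -> 'M[R]_n) (W : 'I_g' -> 'M[R]_n) : 'M[R]_(l * n) :=
  A ord0 *t 1%:M
  + \sum_(j < g) A (lift ord0 (lshift g' j)) *t X j
  + \sum_(j < g') A (lift ord0 (rshift g j)) *t W j.

(* Coordinate [n] of a sequence is a tuple of matrices of size n.+1, so that the
   sizes range over 1, 2, ... *)
Definition mxtuple_seq (R : realType) (g : nat) : Type :=
  forall n : nat, 'I_g -> 'M[R]_n.+1.

Definition mxsection (R : realType) (g : nat) (F : set (mxtuple_seq R g))
    (n : nat) : set ('I_g -> 'M[R]_n.+1) :=
  [set Z n | Z in F].
Arguments mxsection {R g} F n.

Definition has_free_sdr (R : realType) (g : nat) (F : set (mxtuple_seq R g)) :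
    Prop :=
  exists (l g' : nat) (A : 'I_(g + g').+1 -> 'M[R]_l),
    [/\ (0 < l)%N, forall j, A j \is symmetricmx &
      forall n : nat, mxsection F n =
        [set X : 'I_g -> 'M[R]_n.+1 |
          (forall j, X j \is symmetricmx) /\
          exists W : 'I_g' -> 'M[R]_n.+1,
            (forall j, W j \is symmetricmx) /\
            psdmx (linear_pencil A X W)]].

(* A pair (X, Y) is encoded as a tuple indexed by ['I_2], with X at [ord0] and
   Y at [ord_max]. *)
Definition pow_hypograph (R : realType) (p : R) : set (mxtuple_seq R 2) :=
  [set Z | forall n : nat,
     [/\ psdmx (Z n ord0), psdmx (Z n ord_max) &
         loewner_le (Z n ord_max) (powmx (Z n ord0) p)]].

Definition pow_epigraph (R : realType) (p : R) : set (mxtuple_seq R 2) :=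
  [set Z | forall n : nat,
     [/\ psdmx (Z n ord0), psdmx (Z n ord_max) &
         loewner_le (powmx (Z n ord0) p) (Z n ord_max)]].

Definition pow_epigraph_pd (R : realType) (p : R) : set (mxtuple_seq R 2) :=
  [set Z | forall n : nat,
     [/\ pdmx (Z n ord0), psdmx (Z n ord_max) &
         loewner_le (powmx (Z n ord0) p) (Z n ord_max)]].

(* Main.v *)
Require Import Defs.
From mathcomp Require Import all_boot all_order all_algebra.
From mathcomp Require Import mxtens complex spectral ring lra zify.
From mathcomp Require Import all_classical all_reals all_analysis.

Set Implicit Arguments.
Unset Strict Implicit.
Unset Printing Implicit Defensive.

Import Order.TTheory GRing.Theory Num.Theory.
Import numFieldNormedType.Exports.

Local Open Scope ring_scope.

(** The heart of the matter is the hypograph of X^(s/q) for 0 <= s <= q.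
For scalars, the powers w_r = x^(r/q), 0 <= r <= q, are tied together by
geometric means: w_r^2 = w_(2r) * 1 if 2r <= q, and w_r^2 = w_(2r-q) * x
otherwise. Relaxing each equation to a linear matrix inequality,
<<
  [[W_(2r), W_r], [W_r, I]] >= 0    or    [[W_(2r-q), W_r], [W_r, X]] >= 0,
>>
gives a pencil in X and the auxiliary matrices W_0, ..., W_q ([mean_chain]).
It is satisfied by W_r = X^(r/q) ([mean_chain_powmx]), and conversely it forces
W_r <= X^(r/q) for every r ([mean_chain_le_powmx]).

The converse rests on the maximality of the geometric mean: if P and Q are
positive definite and commute, then [[P, W], [W, Q]] >= 0 implies
W <= (P Q)^(1/2) ([psd_block_geometric_mean]). The matrices W_r need not commute
with X, but their upper bounds do: diagonalize X = E^q and put F = E + eta I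
with eta > 0. If W_r <= c^2 F^r for all r, then each block may be enlarged to
one whose diagonal blocks are powers of F, and maximality gives W_r <= c F^r for
all r ([mean_chain_step]). Some constant works to begin with, as F is
positive definite, so repeated square roots show that every constant above 1
works ([mean_chain_pd]); letting it tend to 1 and eta to 0 gives W_r <= E^r
([mean_chain_le]).

The hypograph is then described by the chain together with Y <= W_s. The two
epigraphs follow by Schur complements: with b = s/q,
X^(2-b) = X (X^b)^(-1) X <= Y amounts to [[Y, X], [X, X^b]] >= 0
([powmx_le_block_subn]), and X^(-b) <= Y to [[Y, I], [I, X^b]] >= 0
([powmx_le_block_oppn]); in both, X^b may be replaced by some W_s <= X^b.
For the last epigraph, X > 0 is the solvability in V of
[[V, I], [I, X]] >= 0 ([pdmxE]).

To turn such finite lists of inequalities into one linear pencil, the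
predicates on tuples of matrices that are given by a pencil with coefficients
independent of the size n ([free_lmi]) are shown to be closed under finite
conjunctions, through block diagonal coefficients. *)

(** * The real spectral theorem *)

Lemma symmxP (R : fieldType) n (A : 'M[R]_n) :
  reflect (A^T = A) (A \is symmetricmx).
Proof.
rewrite is_hermitianmxE expr0 scale1r map_mx_id // eq_sym.
exact: eqP.
Qed.

(** The reflection exchanging [u] with the first basis vector is orthogonal and
    symmetric, and its first row is [u]. *)
Lemma householder (R : realFieldType) n (u : 'rV[R]_n.+1) :
  u *m u^T = 1%:M ->
  exists2 H : 'M[R]_n.+1, H^T *m H = 1%:M & row 0 H = u.
Proof.
move=> u1; pose e : 'rV[R]_n.+1 := delta_mx 0 0.
have e1 : e *m e^T = 1%:M.
  by rewrite trmx_delta mul_delta_mx; apply/matrixP => i j; rewrite !ord1 !mxE.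
have [ue|uNe] := eqVneq u e.
  by exists 1%:M; rewrite ?trmx1 ?mul1mx // row1 ue.
have [w wE] : {w : 'rV[R]_n.+1 | w = e - u} by exists (e - u).
have w0 : w != 0 by rewrite wE subr_eq0 eq_sym.
pose b := (w *m w^T) 0 0.
have wwE : w *m w^T = b%:M.
  by apply/matrixP => i j; rewrite !ord1 [RHS]mxE eqxx mulr1n.
have b0 : b != 0.
  apply: contraNneq w0 => /eqP; rewrite /b mxE psumr_eq0; last first.
    by move=> j _; rewrite !mxE -expr2 sqr_ge0.
  move=> /allP w0; apply/eqP/rowP => j.
  move: (w0 j (mem_index_enum _)) => /=.
  by rewrite !mxE -expr2 sqrf_eq0 => /eqP.
pose H := 1%:M - (2 / b) *: (w^T *m w).
have HT : H^T = H by rewrite /H linearB linearZ /= trmx1 trmx_mul trmxK.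
exists H.
  rewrite HT /H mulmxBl mul1mx mulmxBr mulmx1 -scalemxAl -scalemxAr.
  rewrite -[w^T *m w *m _]mulmxA [w *m (_ *m _)]mulmxA wwE mul_scalar_mx.
  rewrite -scalemxAr !scalerA !mulrA.
  have -> : 2 / b * 2 / b * b = 2 / b + 2 / b by field.
  by rewrite scalerDl opprB addrK subrK.
rewrite rowE -/e /H mulmxBr mulmx1 -scalemxAr mulmxA.
have eu : (e *m u^T) 0 0 = (u *m e^T) 0 0.
  by rewrite -[in RHS](trmxK u) -trmx_mul [RHS]mxE.
have -> : e *m w^T = (b / 2)%:M.
  apply/matrixP => i j; rewrite !ord1 [RHS]mxE eqxx mulr1n /b wE.
  rewrite !linearB /= !mulmxBl u1 e1.
  move: eu; rewrite !mxE /= => ->. by field.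
rewrite mul_scalar_mx scalerA.
have -> : 2 / b * (b / 2) = 1 by field.
by rewrite scale1r wE opprB addrC subrK.
Qed.

(** Over [R[i]], the matrix is Hermitian, so all its eigenvalues there are real;
    an eigenvalue lying in the smaller field is already an eigenvalue there. *)
Lemma symmx_eigenvalue (R : rcfType) n (A : 'M[R]_n.+1) :
  A^T = A -> exists a : R, eigenvalue A a.
Proof.
move=> sA; pose AC := map_mx (@real_complex R) A.
have ACh : AC \is hermsymmx.
  apply: realsym_hermsym.
    by apply/symmxP; rewrite /AC map_trmx sA.
  by apply/mxOverP => i j; rewrite mxE; apply/complex_realP; exists (A i j).
have /orthomx_spectralP ACE := hermitian_normalmx ACh.
have /mxOverP/(_ 0 0)/complex_realP[a aE] := hermitian_spectral_diag_real ACh.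
exists a; rewrite -(eigenvalue_map (@real_complex R)) -/AC.
rewrite -[X in eigenvalue _ X]/(a%:C)%C -aE.
set P := spectralmx AC in ACE *; have Pu : P \in unitmx by exact: spectral_unit.
apply/eigenvalueP; exists (row 0 P).
  rewrite -row_mul [in X in row 0 X]ACE !mulmxA mulmxV // mul1mx.
  by rewrite row_mul row_diag_mx -scalemxAl -rowE.
apply/eqP => P0; have := congr1 (mulmx^~ (invmx P)) P0.
rewrite -row_mul mulmxV // mul0mx => /rowP/(_ 0)/eqP.
by rewrite !mxE eqxx oner_eq0.
Qed.

Lemma spectral_decomposition_block (R : realType) m n (A H : 'M[R]_(m + n))
    (a : 'rV[R]_m) (B Q : 'M[R]_n) (d : 'rV[R]_n) :
  H^T *m H = 1%:M -> A = H^T *m block_mx (diag_mx a) 0 0 B *m H ->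
  spectral_decomposition B (Q, d) ->
  spectral_decomposition A (block_mx 1%:M 0 0 Q *m H, row_mx a d).
Proof.
move=> HH AE [/= QQ BdE].
have QT : (block_mx 1%:M 0 0 Q)^T = block_mx 1%:M 0 0 Q^T :> 'M[R]_(m + n).
  by rewrite tr_block_mx !trmx0 trmx1.
split; rewrite /= trmx_mul QT.
  rewrite mulmxA -[X in X *m H]mulmxA mulmx_block.
  by rewrite !mul0mx !mulmx0 !mul1mx !addr0 !add0r QQ -scalar_mx_block mulmx1.
rewrite {}AE; rewrite diag_mx_row !mulmxA; congr (_ *m _).
rewrite -!mulmxA; congr (_ *m _); rewrite !mulmx_block.
by rewrite !(mul0mx, mulmx0) !mul1mx !mulmx1 !addr0 !add0r mulmxA -BdE mulmx0.
Qed.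

(** Deflation: an orthogonal matrix whose first row is a unit eigenvector
    conjugates [A] to a block diagonal matrix with a smaller symmetric block. *)
Lemma symmx_spectral (R : realType) n (A : 'M[R]_n) :
  A^T = A -> exists Qd, spectral_decomposition A Qd.
Proof.
elim: n => [|n IH] in A *.
  by move=> _; exists (1%:M, 0); split; apply/matrixP => -[].
move=> sA; have [a /eigenvalueP[v vA v0]] := symmx_eigenvalue sA.
have vv : 0 < (v *m v^T) 0 0.
  have [j vj] : exists j, v 0 j != 0.
    apply/existsP; apply: contraNT v0 => /existsPn v0.
    by apply/eqP/rowP => j; rewrite mxE; apply/eqP; move: (v0 j); rewrite negbK.
  rewrite mxE (bigD1 j) //= ltr_wpDr //.
    by apply: sumr_ge0 => k _; rewrite mxE -expr2 sqr_ge0.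
  by rewrite mxE -expr2 exprn_even_gt0.
pose s := Num.sqrt ((v *m v^T) 0 0); pose u := s^-1 *: v.
have s0 : s != 0 by rewrite gt_eqF // sqrtr_gt0.
have uA : u *m A = a *: u by rewrite /u -scalemxAl vA !scalerA mulrC.
have u1 : u *m u^T = 1%:M.
  rewrite /u linearZ /= -scalemxAl -scalemxAr scalerA.
  apply/matrixP => i j; rewrite !ord1 [LHS]mxE [RHS]mxE eqxx -invfM -expr2.
  by rewrite sqr_sqrtr ?ltW // mulVf // gt_eqF.
have [H HH rH] := householder u1.
have HH' := mulmx1C HH.
have [B BH] : {B : 'M[R]_(1 + n) | B = H *m A *m H^T} by exists (H *m A *m H^T).
have sB : B^T = B by rewrite BH !trmx_mul trmxK sA mulmxA.
have B0 : row 0 B = a *: delta_mx 0 0.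
  rewrite BH !row_mul rH uA -scalemxAl -rH -row_mul HH'.
  by rewrite row1.
have Bur : ursubmx B = 0.
  apply/matrixP => i j; rewrite !ord1 !mxE.
  have /rowP/(_ (rshift 1 j)) := B0; rewrite !mxE /= mulr0 => <-.
  by congr (B _ _); apply: val_inj.
have Bul : ulsubmx B = diag_mx a%:M.
  apply/matrixP => i j; rewrite !ord1 !mxE /= !mulr1n.
  have /rowP/(_ 0) := B0; rewrite !mxE /= mulr1 => <-.
  by congr (B _ _); apply: val_inj.
have Bdl : dlsubmx B = 0 by rewrite -[B]sB -trmx_ursub Bur trmx0.
have BE : B = block_mx (diag_mx a%:M) 0 0 (drsubmx B).
  by rewrite -[LHS]submxK Bur Bul Bdl.
have /IH[[Q d] [/= QQ BdE]] : (drsubmx B)^T = drsubmx B.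
  by rewrite trmx_drsub sB.
have AE : A = H^T *m B *m H.
  by rewrite BH !mulmxA HH mul1mx -mulmxA HH mulmx1.
have AB : A = H^T *m block_mx (diag_mx a%:M) 0 0 (drsubmx B) *m H.
  by rewrite -BE.
have := @spectral_decomposition_block R 1 n A H a%:M _ Q d HH AB.
by move=> /(_ (conj QQ BdE)) ?; eexists; eassumption.
Qed.

(** * Quadratic forms and two-by-two block inequalities *)

Definition bform (R : realType) n (A : 'M[R]_n) (x y : 'cV[R]_n) : R :=
  (x^T *m A *m y) 0 0.

(** The quadratic-form part of the Loewner order: it makes sense without symmetry
    of the matrices, so bounds can be chained without carrying symmetry proofs. *)
Definition form_le (R : realType) n (A B : 'M[R]_n) : Prop :=
  forall x, bform A x x <= bform B x x.

(** Positivity of the block matrix [[A, B], [B^T, C]], tested on pairs of vectors. *)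
Definition psd_block (R : realType) n (A B C : 'M[R]_n) : Prop :=
  forall x y, 0 <= bform A x x + bform B x y *+ 2 + bform C y y.

Section Forms.
Variables (R : realType) (n : nat).
Implicit Types (A B C Q W : 'M[R]_n) (x y : 'cV[R]_n) (d e f g p q : 'rV[R]_n).

Lemma bform_diag d x y :
  bform (diag_mx d) x y = \sum_i d 0 i * x i 0 * y i 0.
Proof.
rewrite /bform mul_mx_diag mxE; apply: eq_bigr => i _.
by rewrite !mxE mulrC [x i 0 * _]mulrC mulrC.
Qed.

Lemma bformC A x y : A^T = A -> bform A x y = bform A y x.
Proof.
move=> sA; have -> : bform A x y = (x^T *m A *m y)^T 0 0 by rewrite mxE.
by rewrite !trmx_mul trmxK sA mulmxA.
Qed.

Lemma bform_congr Q A x y :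
  bform (Q^T *m A *m Q) x y = bform A (Q *m x) (Q *m y).
Proof. by rewrite /bform trmx_mul !mulmxA. Qed.

Lemma bformBl A B x y : bform (A - B) x y = bform A x y - bform B x y.
Proof. by rewrite /bform mulmxBr mulmxBl [LHS]mxE [X in _ + X]mxE. Qed.

Lemma bformZl c A x y : bform (c *: A) x y = c * bform A x y.
Proof. by rewrite /bform -scalemxAr -scalemxAl mxE. Qed.

Lemma bformZy c A x y : bform A x (c *: y) = c * bform A x y.
Proof. by rewrite /bform -scalemxAr mxE. Qed.

Lemma bformZx c A x y : bform A (c *: x) y = c * bform A x y.
Proof. by rewrite /bform linearZ /= -!scalemxAl mxE. Qed.

Lemma bform0x A y : bform A 0 y = 0.
Proof. by rewrite /bform trmx0 !mul0mx mxE. Qed.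

Lemma bformx0 A x : bform A x 0 = 0.
Proof. by rewrite /bform mulmx0 mxE. Qed.

Lemma bform_sqr_ge0 x : 0 <= bform 1%:M x x.
Proof.
rewrite -diag_const_mx bform_diag sumr_ge0 // => i _.
by rewrite mxE mul1r -expr2 sqr_ge0.
Qed.

Lemma form_leP A B : A^T = A -> B^T = B -> (form_le A B <-> loewner_le A B).
Proof.
move=> sA sB; split=> [AB|[_ AB] x].
  split; first by apply/symmxP; rewrite linearB /= sA sB.
  by move=> x; rewrite -/(bform _ x x) bformBl subr_ge0.
by rewrite -subr_ge0 -bformBl; exact: AB.
Qed.

Lemma form_le_trans A B C : form_le A B -> form_le B C -> form_le A C.
Proof. by move=> AB BC x; exact: le_trans (AB x) (BC x). Qed.

Lemma form_le_diag d e : (forall i, d 0 i <= e 0 i) ->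
  form_le (diag_mx d) (diag_mx e).
Proof.
move=> de x; rewrite !bform_diag ler_sum // => i _.
by rewrite -!mulrA ler_wpM2r // -expr2 sqr_ge0.
Qed.

Lemma form_le_congr Q A B : form_le A B ->
  form_le (Q^T *m A *m Q) (Q^T *m B *m Q).
Proof. by move=> AB x; rewrite !bform_congr. Qed.

Lemma psd_block_mono A A' B C C' : form_le A A' -> form_le C C' ->
  psd_block A B C -> psd_block A' B C'.
Proof.
move=> AA CC ABC x y; apply: le_trans (ABC x y) _.
by rewrite lerD // lerD2r.
Qed.

Lemma psd_block_congr Q A B C : psd_block A B C ->
  psd_block (Q^T *m A *m Q) (Q^T *m B *m Q) (Q^T *m C *m Q).
Proof. by move=> ABC x y; rewrite !bform_congr. Qed.

(** Coordinatewise, this is the positivity of a real two-by-two matrix with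
    determinant 0. *)
Lemma psd_block_diag d e f :
  (forall i, 0 <= d 0 i) -> (forall i, 0 <= f 0 i) ->
  (forall i, e 0 i ^+ 2 = d 0 i * f 0 i) ->
  psd_block (diag_mx d) (diag_mx e) (diag_mx f).
Proof.
move=> d0 f0 eE x y; rewrite !bform_diag -sumrMnl -!big_split /=.
apply: sumr_ge0 => i _; move: (eE i) (d0 i) (f0 i).
move: (d 0 i) (e 0 i) (f 0 i) (x i 0) (y i 0) => a b c s t ac a0 c0.
have [a_eq0|aN0] := eqVneq a 0; first last.
  have ap : 0 < a by rewrite lt_def aN0.
  rewrite -(pmulr_rge0 _ ap).
  have -> : a * (a * s * s + b * s * t *+ 2 + c * t * t) =
    (a * s + b * t) ^+ 2 + (a * c - b ^+ 2) * t ^+ 2 by ring.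
  by rewrite -ac subrr mul0r addr0 sqr_ge0.
move: ac; rewrite a_eq0 !mul0r => /eqP; rewrite sqrf_eq0 => /eqP ->.
by rewrite !mul0r mul0rn !add0r -mulrA mulr_ge0 // -expr2 sqr_ge0.
Qed.

(** In an eigenbasis, any bound of the absolute values of the eigenvalues works. *)
Lemma form_le_scalar W : W^T = W -> exists2 c, 0 <= c & form_le W (c *: 1%:M).
Proof.
move=> /symmx_spectral[[Q d] [/= QQ ->]].
exists (\sum_i `|d 0 i|); first exact: sumr_ge0.
have -> : (\sum_i `|d 0 i|) *: 1%:M =
    Q^T *m diag_mx (const_mx (\sum_i `|d 0 i|)) *m Q.
  by rewrite diag_const_mx mul_mx_scalar -scalemxAl QQ.
apply: form_le_congr; apply: form_le_diag => i.
by rewrite mxE (bigD1 i) //= ler_wpDr ?sumr_ge0 // ler_norm.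
Qed.

Lemma bform_diag_gt0 d x : (forall i, 0 < d 0 i) -> x != 0 ->
  0 < bform (diag_mx d) x x.
Proof.
move=> d0 x0; have [j xj] : exists j, x j 0 != 0.
  apply/existsP; apply: contraNT x0 => /existsPn x0.
  by apply/eqP/colP => j; rewrite mxE; apply/eqP; move: (x0 j); rewrite negbK.
rewrite bform_diag (bigD1 j) //= ltr_wpDr //.
  by apply: sumr_ge0 => k _; rewrite -mulrA -expr2 mulr_ge0 ?sqr_ge0 ?ltW.
by rewrite -mulrA -expr2 mulr_gt0 // exprn_even_gt0.
Qed.

(** [W <= G] can be tested on generalized eigenvectors: these are, up to the
    change of variable [G^(-1/2)], the eigenvectors of the symmetric matrix
    [G^(-1/2) W G^(-1/2)]. *)
Lemma form_le_eigen g W : W^T = W -> (forall i, 0 < g 0 i) ->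
  (forall a (v : 'cV_n), v != 0 -> W *m v = a *: (diag_mx g *m v) -> a <= 1) ->
  form_le W (diag_mx g).
Proof.
move=> sW g0 ev x.
pose s : 'rV[R]_n := \row_i Num.sqrt (g 0 i).
pose t : 'rV[R]_n := \row_i (s 0 i)^-1.
have s0 i : s 0 i != 0 by rewrite mxE gt_eqF // sqrtr_gt0.
have DE : diag_mx t *m diag_mx s = 1%:M.
  by rewrite mulmx_diag -diag_const_mx; congr diag_mx; apply/rowP => i;
     rewrite !mxE mulVf //; move: (s0 i); rewrite mxE.
have ED := mulmx1C DE.
have EE : diag_mx s *m diag_mx s = diag_mx g.
  by rewrite mulmx_diag; congr diag_mx; apply/rowP => i;
     rewrite !mxE -expr2 sqr_sqrtr // ltW.
have [D DD] : {D : 'M[R]_n | D = diag_mx t} by eexists.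
have [E EDD] : {E : 'M[R]_n | E = diag_mx s} by eexists.
have sD : D^T = D by rewrite DD tr_diag_mx.
have sE : E^T = E by rewrite EDD tr_diag_mx.
rewrite -DD -EDD in DE ED EE.
have sWW : (D *m W *m D)^T = D *m W *m D by rewrite !trmx_mul sD sW mulmxA.
have [[Q d] [/= QQ WE]] := symmx_spectral sWW.
have QQ' := mulmx1C QQ.
have d1 k : d 0 k <= 1.
  pose z : 'cV_n := Q^T *m delta_mx k 0; pose v := D *m z.
  have Ev : E *m v = z by rewrite /v mulmxA ED mul1mx.
  apply: (ev _ v).
    apply/eqP => v0; have := congr1 (mulmx Q) Ev.
    rewrite v0 !mulmx0 /z mulmxA QQ' mul1mx => /colP/(_ k)/eqP.
    by rewrite !mxE !eqxx eq_sym oner_eq0.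
  have WV : W *m v = E *m (D *m W *m D) *m z by rewrite !mulmxA ED mul1mx.
  rewrite {}WV WE -EE -[E *m E *m v]mulmxA Ev -[in LHS]mulmxA scalemxAr.
  congr (_ *m _); rewrite /z -!mulmxA [Q *m _]mulmxA QQ' mul1mx scalemxAr.
  congr (_ *m _); apply/colP => i; rewrite mul_diag_mx !mxE.
  by case: eqP => [->|]; rewrite ?mulr0.
have -> : bform W x x = bform (D *m W *m D) (E *m x) (E *m x).
  by rewrite -bform_congr sE !mulmxA ED mul1mx -mulmxA DE mulmx1.
rewrite WE bform_congr -[diag_mx g]EE -[E *m E]mul1mx.
have -> : 1%:M *m (E *m E) = E^T *m 1%:M *m E by rewrite sE mulmx1 mul1mx.
rewrite bform_congr -QQ -[X in X *m Q]mulmx1 bform_congr -diag_const_mx.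
by apply: form_le_diag => i; rewrite mxE.
Qed.

(** Maximality of the geometric mean. If [W v = a G v] with [G = diag g], then the
    block form at the pair [(P^-1 G v, - v)] equals [2 (1 - a) v^T Q v], because
    [G P^-1 G = Q]; hence [a <= 1]. *)
Lemma psd_block_geometric_mean p q g W : W^T = W ->
  (forall i, 0 < p 0 i) -> (forall i, 0 < g 0 i) ->
  (forall i, g 0 i ^+ 2 = p 0 i * q 0 i) ->
  psd_block (diag_mx p) W (diag_mx q) -> form_le W (diag_mx g).
Proof.
move=> sW p0 g0 gE pWq; apply: form_le_eigen => // a v v0 Wv.
have q0 i : 0 < q 0 i.
  by rewrite -(pmulr_rgt0 _ (p0 i)) -gE exprn_gt0.
have Q0 := bform_diag_gt0 q0 v0.
pose x : 'cV[R]_n := \col_i (g 0 i / p 0 i * v i 0).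
have gp i : g 0 i * (g 0 i / p 0 i) = q 0 i.
  by rewrite mulrA -expr2 gE mulrC mulKf // gt_eqF.
have := pWq x (-1 *: v); rewrite !bformZy bformZx.
have -> : bform (diag_mx p) x x = bform (diag_mx q) v v.
  rewrite !bform_diag; apply: eq_bigr => i _; rewrite mxE -gp.
  by have := gt_eqF (p0 i); move/negbT => ?; field.
have -> : bform W x v = a * bform (diag_mx q) v v.
  rewrite /bform -mulmxA Wv -scalemxAr mulmxA mxE; congr (_ * _).
  rewrite -/(bform _ x v) -/(bform _ v v) !bform_diag; apply: eq_bigr => i _.
  by rewrite [x i 0]mxE -gp !mulrA.
move: Q0; set Q := bform _ v v => Q0 H.
rewrite -subr_ge0 -(pmulr_rge0 _ Q0); nra.
Qed.

End Forms.

(** * Chains of geometric means *)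

(** If [W k] stands for [X^(k/q)], the two diagonal entries of the block have
    exponents averaging to [r / q], so the block bounds [W r] by a geometric mean
    with the right exponent. The unit matrix is an argument so that the chain is
    linear in all of its data. *)
Definition mean_block (R : realType) n q (one X : 'M[R]_n)
    (W : 'I_q.+1 -> 'M[R]_n) (r : 'I_q.+1) : Prop :=
  if (r.*2 <= q)%N then psd_block (W (inord r.*2)) (W r) one
  else psd_block (W (inord (r.*2 - q))) (W r) X.

Definition mean_chain (R : realType) n q (one X : 'M[R]_n)
    (W : 'I_q.+1 -> 'M[R]_n) : Prop := forall r, mean_block one X W r.

(** When [X] is the [q]-th power of [diag_mx e], its powers with denominator [q]
    are natural powers of [e]. *)
Definition diag_pow (R : realType) n (e : 'rV[R]_n) (r : nat) : 'M[R]_n :=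
  diag_mx (map_mx (fun t => t ^+ r) e).

Section Chain.
Variables (R : realType) (n q : nat).
Implicit Types (e f : 'rV[R]_n) (X : 'M[R]_n) (W : 'I_q.+1 -> 'M[R]_n).

Lemma diag_pow0 e : diag_pow e 0 = 1%:M.
Proof.
by rewrite -diag_const_mx; congr diag_mx; apply/rowP => i; rewrite !mxE.
Qed.

Lemma diag_pow_block e k r m : (forall i, 0 <= e 0 i) -> (r.*2 = k + m)%N ->
  psd_block (diag_pow e k) (diag_pow e r) (diag_pow e m).
Proof.
move=> e0 rkm; apply: psd_block_diag => i; rewrite !mxE ?exprn_ge0 //.
by rewrite -exprM muln2 rkm exprD.
Qed.

Lemma diag_pow_chain e : (forall i, 0 <= e 0 i) ->
  mean_chain 1%:M (diag_pow e q) (fun r : 'I_q.+1 => diag_pow e r).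
Proof.
move=> e0 r; rewrite /mean_block; case: leqP => rq.
  by rewrite -(diag_pow0 e) inordK //; apply: diag_pow_block; rewrite ?addn0.
have := ltn_ord r; rewrite ltnS => rq'.
by rewrite inordK; [apply: diag_pow_block => //; lia|lia].
Qed.

(** The upper bounds [c^2 f^k] and [f^m] of the diagonal blocks have geometric mean
    [c f^r], since [2 r = k + m]. *)
Lemma mean_block_step f c k r m A C (W : 'M[R]_n) : W^T = W -> 0 < c ->
  (forall i, 0 < f 0 i) -> (r.*2 = k + m)%N ->
  form_le A (c ^+ 2 *: diag_pow f k) -> form_le C (diag_pow f m) ->
  psd_block A W C -> form_le W (c *: diag_pow f r).
Proof.
have diagZ (b : R) j :
    b *: diag_pow f j = diag_mx (map_mx (fun t => b * t ^+ j) f).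
  by rewrite /diag_pow -linearZ; congr diag_mx; apply/rowP => i; rewrite !mxE.
move=> sW c0 f0 rkm Af Cf AWC; rewrite diagZ.
apply: (psd_block_geometric_mean (p := map_mx (fun t => c ^+ 2 * t ^+ k) f)
  (q := map_mx (fun t => t ^+ m) f)) => //.
- by move=> i; rewrite mxE mulr_gt0 ?exprn_gt0.
- by move=> i; rewrite mxE mulr_gt0 ?exprn_gt0.
- by move=> i; rewrite !mxE exprMn -exprM muln2 rkm exprD mulrA.
- by apply: psd_block_mono AWC => //; rewrite -diagZ.
Qed.

Lemma mean_chain_step f c X W : (forall r, (W r)^T = W r) -> 0 < c ->
  (forall i, 0 < f 0 i) -> form_le X (diag_pow f q) -> mean_chain 1%:M X W ->
  (forall r, form_le (W r) (c ^+ 2 *: diag_pow f r)) ->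
  forall r, form_le (W r) (c *: diag_pow f r).
Proof.
move=> sW c0 f0 Xf ch Wc r; have := ch r; rewrite /mean_block.
have := ltn_ord r; rewrite ltnS => rq'.
case: leqP => rq.
- apply: (mean_block_step (k := r.*2) (m := 0)); rewrite ?addn0 //.
    by have := Wc (inord r.*2); rewrite inordK.
  by rewrite diag_pow0.
- apply: (mean_block_step (k := r.*2 - q) (m := q)) => //; first lia.
  by have := Wc (inord (r.*2 - q)); rewrite inordK //; lia.
Qed.

(** As [f] is positive, a multiple of [f^r] dominates the identity, hence
    dominates any given matrix. *)
Lemma mean_chain_apriori f W : (forall r, (W r)^T = W r) ->
  (forall i, 0 < f 0 i) ->
  exists c, forall r, form_le (W r) (c *: diag_pow f r).
Proof.
move=> sW f0.
have Wr r : exists c, 0 <= c /\ form_le (W r) (c *: diag_pow f r).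
  have [b b0 Wb] := form_le_scalar (sW r).
  have s0 : 0 <= \sum_i (f 0 i ^+ r)^-1.
    by apply: sumr_ge0 => i _; rewrite invr_ge0 exprn_ge0 // ltW.
  exists (b * \sum_i (f 0 i ^+ r)^-1); split; first exact: mulr_ge0.
  apply: form_le_trans Wb _.
  rewrite -diag_const_mx /diag_pow -!linearZ; apply: form_le_diag => i.
  rewrite !mxE -mulrA ler_wpM2l // (bigD1 i) //= mulrDl mulVf.
    rewrite lerDl mulr_ge0 ?exprn_ge0 ?(ltW (f0 i)) // sumr_ge0 // => j _.
    by rewrite invr_ge0 exprn_ge0 // ltW.
  by rewrite gt_eqF // exprn_gt0.
have [c cP] := choice Wr.
exists (\sum_r c r) => r x; have [c0 Wc] := cP r.
apply: le_trans (Wc x) _; rewrite !bformZl ler_wpM2r //.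
  rewrite bform_diag sumr_ge0 // => i _; rewrite -mulrA -expr2.
  by rewrite mulr_ge0 ?sqr_ge0 // mxE exprn_ge0 // ltW.
by rewrite (bigD1 r) //= lerDl sumr_ge0 // => j _; case: (cP j).
Qed.

Lemma bernoulli (c : R) m : 0 <= c -> 1 + c *+ m <= (1 + c) ^+ m.
Proof.
move=> c0; elim: m => [|m IH]; first by rewrite mulr0n addr0 expr0.
rewrite exprS; apply: le_trans (ler_wpM2l _ IH); last by rewrite addr_ge0.
rewrite mulrDr mulr1 mulrS addrA lerD2l.
by rewrite mulrDl mul1r lerDl mulr_ge0 // mulrn_wge0.
Qed.

(** Starting from an a priori constant below [(1 + c)^(2^m)], the square-root step
    [mean_chain_step] halves the exponent [m] times. *)
Lemma mean_chain_pd f c X W : (forall r, (W r)^T = W r) -> 0 < c ->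
  (forall i, 0 < f 0 i) -> form_le X (diag_pow f q) -> mean_chain 1%:M X W ->
  forall r, form_le (W r) ((1 + c) *: diag_pow f r).
Proof.
move=> sW c0 f0 Xf ch.
have [b Wb] := mean_chain_apriori sW f0.
pose m := Num.bound (b / c).
have bm : b <= (1 + c) ^+ (2 ^ m).
  apply: le_trans (bernoulli _ (ltW c0)).
  have : b / c < (2 ^ m)%:R.
    by rewrite natrX; apply: upper_nthrootP; exact: leqnn.
  rewrite ltr_pdivrMr // mulr_natl => /ltW; lra.
have c10 : 0 < 1 + c by rewrite addr_gt0.
have : forall r, form_le (W r) ((1 + c) ^+ (2 ^ m) *: diag_pow f r).
  move=> r x; apply: le_trans (Wb r x) _; rewrite !bformZl ler_wpM2r //.
  rewrite bform_diag sumr_ge0 // => i _; rewrite -mulrA -expr2.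
  by rewrite mulr_ge0 ?sqr_ge0 // mxE exprn_ge0 // ltW.
elim: (m) => [//|j IH] H; apply: IH.
apply: (mean_chain_step _ _ f0 Xf ch) => //; first exact: exprn_gt0.
by move=> r; rewrite -exprM -expnSr.
Qed.

(** The bound for positive definite matrices is applied to [f = e + eta] with the
    constant [1 + eta]; at a fixed vector its right-hand side is a polynomial in
    [eta], so [eta] may tend to 0 from the right. *)
Lemma mean_chain_le e W : (forall r, (W r)^T = W r) -> (forall i, 0 <= e 0 i) ->
  mean_chain 1%:M (diag_pow e q) W -> forall r, form_le (W r) (diag_pow e r).
Proof.
move=> sW e0 ch r x.
(* The bound at [x], as a polynomial in the perturbation [eta]. *)
pose P : {poly R} :=
  \sum_i (1 + 'X) * ('X + (e 0 i)%:P) ^+ r * ((x i 0) ^+ 2)%:P.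
have PE c : P.[c] = bform ((1 + c) *: diag_pow (map_mx (+%R c) e) r) x x.
  rewrite bformZl bform_diag mulr_sumr horner_sum; apply: eq_bigr => i _.
  by rewrite !hornerE /= !mxE -!mulrA -expr2.
have -> : bform (diag_pow e r) x x = P.[0].
  rewrite PE addr0 scale1r; congr (bform (diag_mx _) x x).
  by apply/rowP => i; rewrite !mxE add0r.
apply: (@cvgr_to_ge _ (at_right (0 : R)) _ _ (horner P)).
  by apply: cvg_at_right_filter; exact: continuous_horner.
near=> c; have c0 : 0 < c by near: c; exact: nbhs_right_gt.
rewrite PE; apply: (mean_chain_pd _ _ _ _ ch) => //.
  by move=> i; rewrite mxE ltr_wpDr.
apply: form_le_diag => i; rewrite !mxE.
rewrite lerXn2r // ?nnegrE ?addr_ge0 ?(ltW c0) //.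
by rewrite ler_wpDl ?(ltW c0).
Unshelve. all: by end_near.
Qed.

End Chain.

(** * Powers of a positive semidefinite matrix *)

Section Powers.
Variables (R : realType) (n : nat).
Implicit Types (X Y Q V : 'M[R]_n) (b c d e h : 'rV[R]_n).

Lemma congrK Q Y : Q^T *m Q = 1%:M -> Q^T *m (Q *m Y *m Q^T) *m Q = Y.
Proof. by move=> QQ; rewrite !mulmxA QQ mul1mx -mulmxA QQ mulmx1. Qed.

Lemma form_le_congrE Q X Y : Q^T *m Q = 1%:M ->
  form_le (Q^T *m X *m Q) Y <-> form_le X (Q *m Y *m Q^T).
Proof.
move=> QQ; split=> [/(form_le_congr Q^T)|/(form_le_congr Q)].
  rewrite trmxK [Q *m (_ *m _ *m _)]mulmxA [Q *m (_ *m _)]mulmxA (mulmx1C QQ).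
  by rewrite mul1mx -[X *m Q *m _]mulmxA (mulmx1C QQ) mulmx1.
by rewrite congrK.
Qed.

(** A Schur complement in which [h] plays the role of [b / c]. This form keeps the
    coordinates where [c] vanishes, as [b] then vanishes too. The test pair is
    [(x, - h x)]. *)
Lemma psd_block_diag_schur Y b c h : (forall i, 0 <= c 0 i) ->
  (forall i, b 0 i = c 0 i * h 0 i) ->
  psd_block Y (diag_mx b) (diag_mx c) <->
  form_le (diag_mx (\row_i (c 0 i * h 0 i ^+ 2))) Y.
Proof.
move=> c0 bE; split=> [H x|YH]; last first.
  apply: (psd_block_mono YH (fun=> lexx _)); apply: psd_block_diag => // i.
    by rewrite mxE mulr_ge0 ?sqr_ge0.
  by rewrite mxE bE; ring.
have := H x (-1 *: (diag_mx h *m x)); rewrite !bformZy bformZx !bform_diag.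
set T := (X in _ + -1 * (-1 * X)).
have TE : T = \sum_i (\row_i (c 0 i * h 0 i ^+ 2)) 0 i * x i 0 * x i 0.
  by apply: eq_bigr => i _; rewrite mul_diag_mx !mxE; ring.
have SE : \sum_i b 0 i * x i 0 * (diag_mx h *m x) i 0 = T.
  by apply: eq_bigr => i _; rewrite mul_diag_mx !mxE bE; ring.
rewrite -TE SE; lra.
Qed.

Lemma psd_decomposition X : psdmx X ->
  exists Q d, spectral_decomposition X (Q, d) /\ forall i, 0 <= d 0 i.
Proof.
move=> [/symmxP sX X0]; have [[Q d] [/= QQ XE]] := symmx_spectral sX.
exists Q, d; split=> // i; have := X0 (Q^T *m delta_mx i 0).
rewrite -/(bform _ _ _) XE bform_congr mulmxA (mulmx1C QQ) mul1mx bform_diag.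
rewrite (bigD1 i) //= big1 ?addr0 => [|j /negPf ij];
  rewrite !mxE ?ij ?eqxx ?mulr0 //.
by rewrite !mulr1.
Qed.

Lemma powR_root (t : R) q r : 0 <= t -> (0 < q)%N ->
  (t ^+ q) `^ (r%:R / q%:R) = t ^+ r.
Proof.
move=> t0 q0; rewrite -powR_mulrn // -powRrM mulrC divfK ?powR_mulrn //.
by rewrite pnatr_eq0 -lt0n.
Qed.

(** All powers of [X] are expressed in one eigenbasis through the [q]-th roots [e]
    of the eigenvalues, so that powers with denominator [q] become integral
    powers of [e]. *)
Lemma powmx_root X q : psdmx X -> (0 < q)%N ->
  exists Q e, [/\ Q^T *m Q = 1%:M, forall i, 0 <= e 0 i,
    X = Q^T *m diag_pow e q *m Q &
    forall p,
      powmx X p = Q^T *m diag_mx (map_mx (fun t => (t ^+ q) `^ p) e) *m Q].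
Proof.
move=> /psd_decomposition[Q [d [dec d0]]] q0.
pose e := map_mx (fun t => t `^ q%:R^-1) d.
have eq : map_mx (fun t => t ^+ q) e = d.
  apply/rowP => i; rewrite !mxE -powR_mulrn ?powR_ge0 // -powRrM.
  rewrite mulVf ?powRr1 //.
  by rewrite pnatr_eq0 -lt0n.
exists Q, e; have [/= QQ XE] := dec; split=> //.
- by move=> i; rewrite mxE powR_ge0.
- by rewrite /diag_pow eq.
- by move=> p; rewrite (powmxE p dec) -eq -map_mx_comp.
Qed.

Lemma powmx_natdiv X q r Q e : (0 < q)%N -> (forall i, 0 <= e 0 i) ->
  (forall p,
    powmx X p = Q^T *m diag_mx (map_mx (fun t => (t ^+ q) `^ p) e) *m Q) ->
  powmx X (r%:R / q%:R) = Q^T *m diag_pow e r *m Q.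
Proof.
move=> q0 e0 ->; congr (_ *m diag_mx _ *m _); apply/rowP => i.
by rewrite !mxE powR_root.
Qed.

Lemma congr_diag_sym Q d : (Q^T *m diag_mx d *m Q)^T = Q^T *m diag_mx d *m Q.
Proof. by rewrite !trmx_mul trmxK tr_diag_mx mulmxA. Qed.

Lemma powmx_sym X p : (powmx X p)^T = powmx X p.
Proof. exact: congr_diag_sym. Qed.

Lemma mean_chain_powmx X q : psdmx X -> (0 < q)%N ->
  mean_chain 1%:M X (fun r : 'I_q.+1 => powmx X (r%:R / q%:R)).
Proof.
move=> X0 q0; have [Q [e [QQ e0 XE pE]]] := powmx_root X0 q0.
have := diag_pow_chain (q := q) e0.
move=> ch r; have := ch r; rewrite /mean_block !(powmx_natdiv _ q0 e0 pE).
rewrite XE; case: ifP => _ /(psd_block_congr Q) //.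
by rewrite mulmx1 QQ.
Qed.

Lemma mean_chain_congr q one X W Q : mean_chain (q := q) one X W ->
  mean_chain (Q *m one *m Q^T) (Q *m X *m Q^T) (fun r => Q *m W r *m Q^T).
Proof.
move=> ch r; have := ch r; rewrite /mean_block.
by case: ifP => _ /(psd_block_congr Q^T); rewrite trmxK.
Qed.

Lemma mean_chain_le_powmx X q (W : 'I_q.+1 -> 'M[R]_n) : psdmx X -> (0 < q)%N ->
  (forall r, (W r)^T = W r) -> mean_chain 1%:M X W ->
  forall r, form_le (W r) (powmx X (r%:R / q%:R)).
Proof.
move=> X0 q0 sW ch r; have [Q [e [QQ e0 XE pE]]] := powmx_root X0 q0.
rewrite (powmx_natdiv _ q0 e0 pE) -[W r](congrK (W r) QQ).
apply: form_le_congr.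
have := mean_chain_congr Q ch; rewrite mulmx1 (mulmx1C QQ).
have -> : Q *m X *m Q^T = diag_pow e q.
  rewrite XE [Q *m (_ *m _ *m _)]mulmxA [Q *m (_ *m _)]mulmxA (mulmx1C QQ).
  by rewrite mul1mx -mulmxA (mulmx1C QQ) mulmx1.
move=> /mean_chain_le; apply => // k.
by rewrite !trmx_mul trmxK sW mulmxA.
Qed.

Lemma psd_block_congrE Q X Y V : Q^T *m Q = 1%:M ->
  psd_block Y (Q^T *m X *m Q) (Q^T *m V *m Q) <->
  psd_block (Q *m Y *m Q^T) X V.
Proof.
move=> QQ; split=> [/(psd_block_congr Q^T)|/(psd_block_congr Q)].
  rewrite trmxK ![Q *m (_ *m _ *m _)]mulmxA ![Q *m (_ *m _)]mulmxA (mulmx1C QQ).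
  by rewrite !mul1mx -![_ *m Q *m _]mulmxA (mulmx1C QQ) !mulmx1.
by rewrite congrK.
Qed.

(** The Schur complement of [X^b] in [[Y, X], [X, X^b]] is [Y - X X^(-b) X], with
    [b = s / q]; in the eigenbasis the ratio of [X] to [X^b] is [e^(q - s)], which
    makes sense for singular [X] because [s <= q]. *)
Lemma powmx_le_block_subn X Y q s : psdmx X -> (0 < q)%N -> (s <= q)%N ->
  psd_block Y X (powmx X (s%:R / q%:R)) <->
  form_le (powmx X (2 - s%:R / q%:R)) Y.
Proof.
move=> X0 q0 sq; have [Q [e [QQ e0 XE pE]]] := powmx_root X0 q0.
have -> : 2 - s%:R / q%:R = (2 * q - s)%N%:R / q%:R :> R.
  rewrite natrB ?natrM; last lia.
  by field; rewrite pnatr_eq0 -lt0n.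
rewrite !(powmx_natdiv _ q0 e0 pE) {1}XE psd_block_congrE // form_le_congrE //.
rewrite (psd_block_diag_schur _ (h := map_mx (fun t => t ^+ (q - s)) e)) //.
- rewrite /diag_pow; suff <- : \row_i (map_mx (fun t => t ^+ s) e 0 i *
    map_mx (fun t => t ^+ (q - s)) e 0 i ^+ 2) =
    map_mx (fun t => t ^+ (2 * q - s)) e by [].
  by apply/rowP => i; rewrite !mxE -exprM -exprD; congr (_ ^+ _); lia.
- by move=> i; rewrite mxE exprn_ge0.
- by move=> i; rewrite !mxE -exprD; congr (_ ^+ _); lia.
Qed.

Lemma pdmx_psd X : pdmx X -> psdmx X.
Proof.
move=> [sX X0]; split=> // v; have [->|v0] := eqVneq v 0; last exact/ltW/X0.
by rewrite mulmx0 mxE.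
Qed.

Lemma pdmx_congr_diag Q d : Q^T *m Q = 1%:M ->
  pdmx (Q^T *m diag_mx d *m Q) -> forall i, 0 < d 0 i.
Proof.
move=> QQ [_ pd] i; have := pd (Q^T *m delta_mx i 0).
rewrite -/(bform _ _ _) bform_congr mulmxA (mulmx1C QQ) mul1mx bform_diag.
rewrite (bigD1 i) //= big1 ?addr0 => [|j /negPf ij];
  rewrite !mxE ?ij ?eqxx ?mulr0 //.
rewrite !mulr1; apply; apply/eqP => /(congr1 (mulmx Q)).
rewrite mulmxA (mulmx1C QQ) mul1mx mulmx0 => /colP/(_ i)/eqP.
by rewrite !mxE !eqxx oner_eq0.
Qed.

Lemma powmx_le_block_oppn X Y q s : pdmx X -> (0 < q)%N ->
  psd_block Y 1%:M (powmx X (s%:R / q%:R)) <->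
  form_le (powmx X (- (s%:R / q%:R))) Y.
Proof.
move=> X0 q0; have [Q [e [QQ e0 XE pE]]] := powmx_root (pdmx_psd X0) q0.
have e1 i : e 0 i != 0.
  have := X0; rewrite XE => /(pdmx_congr_diag QQ)/(_ i).
  rewrite [X in 0 < X]mxE => H.
  by apply: contraTneq H => ->; rewrite expr0n gtn_eqF // ltxx.
rewrite (powmx_natdiv _ q0 e0 pE) pE.
have -> : 1%:M = Q^T *m diag_mx (const_mx 1) *m Q.
  by rewrite diag_const_mx mulmx1.
rewrite psd_block_congrE // form_le_congrE //.
rewrite (psd_block_diag_schur _ (h := map_mx (fun t => t ^- s) e)) //.
- suff <- : \row_i (map_mx (fun t => t ^+ s) e 0 i *
    map_mx (fun t => t ^- s) e 0 i ^+ 2) =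
    map_mx (fun t => (t ^+ q) `^ (- (s%:R / q%:R))) e by [].
  apply/rowP => i; rewrite !mxE powRN powR_root // expr2 mulVKf //.
  by rewrite expf_neq0.
- by move=> i; rewrite mxE exprn_ge0.
- by move=> i; rewrite !mxE divff // expf_neq0.
Qed.

(** [V = X^-1] is a witness. Conversely, if the form of [X] vanished at [v], the
    block form would be affine and nonconstant on the pairs [(v, t v)], hence
    negative somewhere. *)
Lemma pdmxE X : X^T = X ->
  pdmx X <-> exists V, V^T = V /\ psd_block V 1%:M X.
Proof.
move=> sX; split=> [X0|[V [_ VX]]].
  have [Q [d [[/= QQ XE] d0]]] := psd_decomposition (pdmx_psd X0).
  have d1 i : 0 < d 0 i by move: X0; rewrite XE => /(pdmx_congr_diag QQ).
  exists (Q^T *m diag_mx (map_mx (fun t => t^-1) d) *m Q).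
  split; first exact: congr_diag_sym.
  have {1}-> : 1%:M = Q^T *m diag_mx (const_mx 1) *m Q.
    by rewrite diag_const_mx mulmx1.
  rewrite XE; apply: psd_block_congr; apply: psd_block_diag => i; rewrite ?mxE.
  - by rewrite invr_ge0 d0.
  - exact: d0.
  - by rewrite expr1n mulVf // gt_eqF.
split; first exact/symmxP.
move=> v v0; rewrite -/(bform _ _ _).
have v1 : 0 < bform 1%:M v v.
  by rewrite -diag_const_mx; apply: bform_diag_gt0 => // i; rewrite mxE.
have := VX v (- ((bform V v v + 1) / bform 1%:M v v) *: v).
rewrite !bformZy bformZx.
have := VX 0 v; rewrite !bform0x mul0rn !add0r.
rewrite le0r => /orP[/eqP ->|//]; rewrite !mulr0 addr0 mulNr divfK ?gt_eqF //.
have := VX v 0; rewrite !bformx0 mul0rn !addr0; lra.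
Qed.

End Powers.

(** * Predicates defined by a linear pencil *)

(** Constant terms are treated as the coefficient of one more variable, which is
    later set to the identity matrix. *)
Definition free_lmi (R : realType) N
    (P : forall n, ('I_N -> 'M[R]_n) -> Prop) : Prop :=
  exists l (A : 'I_N -> 'M[R]_l),
    [/\ (0 < l)%N, forall k, (A k)^T = A k &
      forall n (Z : 'I_N -> 'M[R]_n), (forall k, (Z k)^T = Z k) ->
        P n Z <-> psdmx (\sum_k A k *t Z k)].

Lemma sum_mxtens_index (R : realType) l n (F : 'I_(l * n) -> R) :
  \sum_k F k = \sum_i \sum_a F (mxtens_index (i, a)).
Proof.
rewrite pair_bigA /=.
apply: (reindex (fun p : 'I_l * 'I_n => mxtens_index (p.1, p.2))).
exists (@mxtens_unindex l n) => [[i a]|k] _ /=; first exact: mxtens_indexK.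
exact: mxtens_unindexK.
Qed.

Lemma bformE (R : realType) n (A : 'M[R]_n) x y :
  bform A x y = \sum_i \sum_j x i 0 * A i j * y j 0.
Proof.
rewrite /bform mxE exchange_big; apply: eq_bigr => j _.
by rewrite mxE mulr_suml; apply: eq_bigr => i _; rewrite mxE.
Qed.

Lemma bform_sum (R : realType) n I (r : seq I) (P : pred I)
    (A : I -> 'M[R]_n) x y :
  bform (\sum_(i <- r | P i) A i) x y = \sum_(i <- r | P i) bform (A i) x y.
Proof. by rewrite /bform mulmx_sumr mulmx_suml summxE. Qed.

Lemma bform_tens (R : realType) l n (A : 'M[R]_l) (B : 'M[R]_n)
    (v : 'cV[R]_(l * n)) :
  let u (i : 'I_l) : 'cV_n := \col_a v (mxtens_index (i, a)) 0 in
  bform (A *t B) v v = \sum_i \sum_j A i j * bform B (u i) (u j).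
Proof.
rewrite /= bformE sum_mxtens_index; apply: eq_bigr => i _.
under [LHS]eq_bigr do rewrite sum_mxtens_index.
rewrite exchange_big; apply: eq_bigr => j _.
rewrite bformE mulr_sumr; apply: eq_bigr => a _.
rewrite mulr_sumr; apply: eq_bigr => b _.
rewrite tensmxE !mxE; ring.
Qed.

(** A vector of length [l * n] is a family of [l] vectors of length [n]; in these
    terms the form of [A *t Z] is a combination of values of the form of [Z]. *)
Lemma psdmx_pencilP (R : realType) N l n (A : 'I_N -> 'M[R]_l)
    (Z : 'I_N -> 'M[R]_n) :
  (forall k, (A k)^T = A k) -> (forall k, (Z k)^T = Z k) ->
  psdmx (\sum_k A k *t Z k) <->
  forall u : 'I_l -> 'cV_n,
    0 <= \sum_k \sum_i \sum_j A k i j * bform (Z k) (u i) (u j).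
Proof.
move=> sA sZ; split=> [[_ AZ] u|AZ].
  pose v : 'cV[R]_(l * n) :=
    \col_k u (mxtens_unindex k).1 (mxtens_unindex k).2 0.
  have := AZ v; rewrite -/(bform _ _ _) bform_sum.
  congr (0 <= _); apply: eq_bigr => k _; rewrite bform_tens.
  have uE i : \col_a v (mxtens_index (i, a)) 0 = u i.
    by apply/colP => a; rewrite !mxE mxtens_indexK.
  by apply: eq_bigr => i _; apply: eq_bigr => j _; rewrite !uE.
split.
  apply/symmxP; rewrite linear_sum; apply: eq_bigr => k _ /=.
  by rewrite trmx_tens sA sZ.
move=> v; rewrite -/(bform _ _ _) bform_sum.
under eq_bigr => k _ do rewrite bform_tens.
exact: AZ.
Qed.

Section FreeLMI.
Variables (R : realType) (N : nat).
Implicit Type P : forall n, ('I_N -> 'M[R]_n) -> Prop.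

Lemma free_lmi_ext P P' :
  (forall n Z, (forall k, (Z k)^T = Z k) -> P' n Z <-> P n Z) ->
  free_lmi P -> free_lmi P'.
Proof.
move=> PP' [l [A [l0 sA AP]]]; exists l, A; split=> // n Z sZ.
by rewrite PP' // AP.
Qed.

(** The coefficients are block diagonal, so the form of the pencil is the sum of
    the two forms on independent families of vectors. *)
Lemma free_lmi_and P P' : free_lmi P -> free_lmi P' ->
  free_lmi (fun n Z => P n Z /\ P' n Z).
Proof.
move=> [l [A [l0 sA AP]]] [l' [A' [_ sA' AP']]].
exists (l + l')%N, (fun k => block_mx (A k) 0 0 (A' k)).
have sAA k : (block_mx (A k) 0 0 (A' k))^T = block_mx (A k) 0 0 (A' k).
  by rewrite tr_block_mx !trmx0 sA sA'.
split=> //; first by rewrite addn_gt0 l0.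
move=> n Z sZ; rewrite AP // AP' // !psdmx_pencilP //.
have blockE (u : 'I_(l + l') -> 'cV[R]_n) :
    \sum_k \sum_i \sum_j
      block_mx (A k) 0 0 (A' k) i j * bform (Z k) (u i) (u j) =
    \sum_k \sum_i \sum_j
      A k i j * bform (Z k) (u (lshift l' i)) (u (lshift l' j)) +
    \sum_k \sum_i \sum_j
      A' k i j * bform (Z k) (u (rshift l i)) (u (rshift l j)).
  rewrite -big_split; apply: eq_bigr => k _; rewrite big_split_ord /=.
  congr (_ + _); apply: eq_bigr => i _; rewrite big_split_ord /=.
    rewrite [X in _ + X]big1 ?addr0 => [|j _].
      by apply: eq_bigr => j _; rewrite block_mxEul.
    by rewrite block_mxEur mxE mul0r.
  rewrite [X in X + _]big1 ?add0r => [|j _].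
    by apply: eq_bigr => j _; rewrite block_mxEdr.
  by rewrite block_mxEdl mxE mul0r.
split=> [[H H'] u|H]; first by rewrite blockE addr_ge0.
have sum0 m (B : 'I_N -> 'M[R]_m) :
    \sum_k \sum_i \sum_j B k i j * bform (Z k) (0 : 'cV_n) (0 : 'cV_n) = 0.
  by do 3!(rewrite big1 // => ? _); rewrite bform0x mulr0.
split=> u.
- have := H (fun i => if fintype.split i is inl i1 then u i1 else 0).
  rewrite blockE [X in _ + X](_ : _ = 0) ?addr0; last first.
    rewrite -[RHS](sum0 _ A'); do 3!(apply: eq_bigr => ? _).
    by rewrite !(unsplitK (inr _)).
  congr (0 <= _); do 3!(apply: eq_bigr => ? _).
  by rewrite !(unsplitK (inl _)).
- have := H (fun i => if fintype.split i is inr i1 then u i1 else 0).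
  rewrite blockE [X in X + _](_ : _ = 0) ?add0r; last first.
    rewrite -[RHS](sum0 _ A); do 3!(apply: eq_bigr => ? _).
    by rewrite !(unsplitK (inl _)).
  congr (0 <= _); do 3!(apply: eq_bigr => ? _).
  by rewrite !(unsplitK (inr _)).
Qed.

Lemma free_lmi_linear (w : 'I_N -> R) :
  free_lmi (fun n Z => form_le 0 (\sum_k w k *: Z k)).
Proof.
exists 1%N, (fun k => (w k)%:M).
split=> // [k|n Z sZ]; first exact: tr_scalar_mx.
rewrite psdmx_pencilP // => [|k]; last exact: tr_scalar_mx.
have E (u : 'I_1 -> 'cV[R]_n) :
    \sum_k \sum_i \sum_j (w k)%:M i j * bform (Z k) (u i) (u j) =
    bform (\sum_k w k *: Z k) (u 0) (u 0).
  rewrite bform_sum; apply: eq_bigr => k _.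
  by rewrite !big_ord_recl !big_ord0 !addr0 mxE eqxx mulr1n bformZl.
have F0 (x : 'cV[R]_n) : bform 0 x x = 0 by rewrite -(scale0r 0) bformZl mul0r.
split=> [H u|H x]; first by rewrite E -(F0 (u 0)); exact: H.
by rewrite F0; have := H (fun=> x); rewrite E.
Qed.

Lemma free_lmi_forall m (P : 'I_m -> forall n, ('I_N -> 'M[R]_n) -> Prop) :
  (forall i, free_lmi (P i)) -> free_lmi (fun n Z => forall i, P i n Z).
Proof.
elim: m => [|m IH] in P *.
  move=> _; apply: free_lmi_ext (free_lmi_linear (fun=> 0)) => n Z _.
  split=> [_ x|_ []//]; by rewrite big1 // => k _; rewrite scale0r.
move=> PP; have PPl := IH _ (fun i => PP (lift ord0 i)).
apply: free_lmi_ext (free_lmi_and (PP ord0) PPl).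
move=> n Z _; split=> [H|[H0 H] i]; first by split=> [|i]; exact: H.
by case: (unliftP ord0 i) => [j ->|->].
Qed.

Lemma sum_delta_scale n (Z : 'I_N -> 'M[R]_n) a :
  \sum_k (k == a)%:R *: Z k = Z a.
Proof.
rewrite (bigD1 a) //= eqxx scale1r big1 ?addr0 // => k /negPf ->.
by rewrite scale0r.
Qed.

Lemma free_lmi_psd (a : 'I_N) :
  free_lmi (fun n (Z : 'I_N -> 'M[R]_n) => psdmx (Z a)).
Proof.
apply: free_lmi_ext (free_lmi_linear (fun k => (k == a)%:R)) => n Z sZ.
by rewrite sum_delta_scale form_leP ?trmx0 // /loewner_le subr0.
Qed.

Lemma free_lmi_le (a b : 'I_N) :
  free_lmi (fun n (Z : 'I_N -> 'M[R]_n) => form_le (Z a) (Z b)).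
Proof.
have L := free_lmi_linear (fun k => (k == b)%:R - (k == a)%:R).
apply: free_lmi_ext L => n Z sZ.
under eq_bigr do rewrite scalerBl; rewrite sumrB !sum_delta_scale.
rewrite !form_leP ?trmx0 ?linearB ?sZ //= ?sZ //.
by rewrite /loewner_le subr0.
Qed.

Lemma free_lmi_block (a b c : 'I_N) :
  free_lmi (fun n (Z : 'I_N -> 'M[R]_n) => psd_block (Z a) (Z b) (Z c)).
Proof.
pose idx (i j : 'I_2) := if i == 0 then if j == 0 then a else b
  else if j == 0 then b else c.
have idxC i j : idx i j = idx j i by rewrite /idx; do 2!case: ifP.
pose A k : 'M[R]_2 := \matrix_(i, j) (k == idx i j)%:R.
have sA k : (A k)^T = A k by apply/matrixP => i j; rewrite !mxE idxC.
exists 2%N, A; split=> // n Z sZ; rewrite psdmx_pencilP //.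
have E (u : 'I_2 -> 'cV[R]_n) :
    \sum_k \sum_i \sum_j A k i j * bform (Z k) (u i) (u j) =
    bform (Z a) (u 0) (u 0) + bform (Z b) (u 0) (u 1) *+ 2 +
    bform (Z c) (u 1) (u 1).
  rewrite exchange_big /=; under eq_bigr do rewrite exchange_big /=.
  have Zi i j : \sum_k A k i j * bform (Z k) (u i) (u j) =
      bform (Z (idx i j)) (u i) (u j).
    rewrite -[in RHS](sum_delta_scale Z (idx i j)) bform_sum.
    by apply: eq_bigr => k _; rewrite mxE bformZl.
  under eq_bigr do under eq_bigr do rewrite Zi.
  rewrite !big_ord_recl !big_ord0 !addr0 /idx /=.
  rewrite (_ : lift ord0 ord0 = 1) //; last exact: val_inj.
  by rewrite [bform (Z b) (u 1) _]bformC ?sZ // mulr2n !addrA.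
split=> [H u|H x y]; first by rewrite E; exact: H.
by have := H (fun i => if i == 0 then x else y); rewrite E.
Qed.

End FreeLMI.

Lemma free_lmi_mean_chain (R : realType) N q (i1 iX : 'I_N)
    (iW : 'I_q.+1 -> 'I_N) :
  free_lmi (fun n (Z : 'I_N -> 'M[R]_n) =>
    mean_chain (Z i1) (Z iX) (fun r => Z (iW r))).
Proof.
apply: free_lmi_forall => r; rewrite /mean_block.
by case: (r.*2 <= q)%N; exact: free_lmi_block.
Qed.

(** * Free semidefinite representations from linear pencils *)

Definition pencil_atoms (R : realType) g g' n (X : 'I_g -> 'M[R]_n)
    (W : 'I_g' -> 'M[R]_n) (k : 'I_(g + g').+1) : 'M[R]_n :=
  if unlift ord0 k is Some j then
    match fintype.split j with inl a => X a | inr b => W b end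
  else 1%:M.

Section Atoms.
Variables (R : realType) (g g' n : nat).
Variables (X : 'I_g -> 'M[R]_n) (W : 'I_g' -> 'M[R]_n).

Lemma pencil_atoms1 : pencil_atoms X W ord0 = 1%:M.
Proof. by rewrite /pencil_atoms unlift_none. Qed.

Lemma pencil_atomsX j : pencil_atoms X W (lift ord0 (lshift g' j)) = X j.
Proof. by rewrite /pencil_atoms liftK (unsplitK (inl _)). Qed.

Lemma pencil_atomsW j : pencil_atoms X W (lift ord0 (rshift g j)) = W j.
Proof. by rewrite /pencil_atoms liftK (unsplitK (inr _)). Qed.

Lemma pencil_atoms_chain m (i : 'I_m -> 'I_g') :
  (fun r => pencil_atoms X W (lift ord0 (rshift g (i r)))) = (fun r => W (i r)).
Proof. by apply/funext => r; exact: pencil_atomsW. Qed.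

Lemma linear_pencilE l (A : 'I_(g + g').+1 -> 'M[R]_l) :
  linear_pencil A X W = \sum_k A k *t pencil_atoms X W k.
Proof.
rewrite big_ord_recl big_split_ord /= pencil_atoms1 addrA.
by congr (_ + _ + _); apply: eq_bigr => j _;
  rewrite ?pencil_atomsX ?pencil_atomsW.
Qed.

End Atoms.

(** The sections of a product are its factors as soon as no factor is empty. *)
Lemma mxsection_forall (R : realType) g
    (P : forall n, ('I_g -> 'M[R]_n.+1) -> Prop) n :
  (forall m, exists X, P m X) ->
  mxsection [set Z : mxtuple_seq R g | forall m, P m (Z m)]%classic n =
  [set X | P n X]%classic.
Proof.
move=> Pne; have [Z0 Z0P] : exists Z : mxtuple_seq R g, forall m, P m (Z m).
  by exists (fun m => projT1 (cid (Pne m))) => m; exact: projT2 (cid (Pne m)).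
apply/seteqP; split=> [_ [Z ZP <-]|X PX]; first exact: ZP.
pose Z m : 'I_g -> 'M[R]_m.+1 := match pselect (n = m) with
  | left nm => ecast m ('I_g -> 'M[R]_m.+1) nm X
  | right _ => Z0 m end.
exists Z => [m|]; rewrite /Z.
  by case: pselect => [nm|_]; [case: m / nm | exact: Z0P].
by case: pselect => // nn; rewrite (eq_irrelevance nn (erefl n)).
Qed.

Lemma has_free_sdr_of_lmi (R : realType) g g'
    (P : forall n, ('I_g -> 'M[R]_n.+1) -> Prop)
    (L : forall n, ('I_(g + g').+1 -> 'M[R]_n) -> Prop) :
  free_lmi L -> (forall n, exists X, P n X) ->
  (forall n X, P n X <-> (forall j, X j \is symmetricmx) /\
     exists W : 'I_g' -> 'M[R]_n.+1, (forall j, W j \is symmetricmx) /\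
       L n.+1 (pencil_atoms X W)) ->
  has_free_sdr [set Z : mxtuple_seq R g | forall n, P n (Z n)]%classic.
Proof.
move=> [l [A [l0 sA LA]]] Pne PL; exists l, g', A.
split=> // [j|n]; first exact/symmxP.
rewrite mxsection_forall //; apply/seteqP.
have sZ (X : 'I_g -> 'M[R]_n.+1) (W : 'I_g' -> 'M[R]_n.+1) :
    (forall j, X j \is symmetricmx) -> (forall j, W j \is symmetricmx) ->
    forall k, (pencil_atoms X W k)^T = pencil_atoms X W k.
  move=> sX sW k; rewrite /pencil_atoms.
  case: unlift => [j|]; last exact: trmx1.
  by case: fintype.split => ?; apply/symmxP.
split=> X /=; rewrite ?PL => -[sX [W [sW XW]]].
  split=> //; exists W; split=> //.
  by rewrite linear_pencilE -LA //; exact: sZ.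
split=> //; exists W; split=> //.
by rewrite LA -?linear_pencilE //; exact: sZ.
Qed.

Lemma powmx1 (R : realType) n (p : R) : powmx (1%:M : 'M[R]_n) p = 1%:M.
Proof.
rewrite (@powmxE _ _ _ _ 1%:M (const_mx 1)).
  by rewrite trmx1 mul1mx mulmx1 -diag_const_mx; congr diag_mx;
    apply/rowP => i; rewrite !mxE powR1.
by split; rewrite /= ?diag_const_mx !trmx1 !mulmx1.
Qed.

(** * The hypograph and the two epigraphs *)

Lemma rat_unit_frac (R : realType) (p : rat) : 0 <= p <= 1 ->
  exists q s : nat, [/\ (0 < q)%N, (s <= q)%N & ratr p = s%:R / q%:R :> R].
Proof.
move=> /andP[p0 p1]; exists `|denq p|%N, `|numq p|%N.
have dE : `|denq p|%N%:Z = denq p by rewrite gez0_abs // ltW.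
have nE : `|numq p|%N%:Z = numq p by rewrite gez0_abs // numq_ge0.
split.
- by rewrite absz_gt0 denq_neq0.
- rewrite -lez_nat dE nE; move: p1.
  by rewrite -[X in X <= _]divq_num_den ler_pdivrMr ?mul1r ?ltr0z // ler_int.
- by rewrite /ratr !pmulrn dE nE.
Qed.

Lemma sym_psdmx (R : realType) n (X : 'M[R]_n) : psdmx X -> X^T = X.
Proof. by case=> /symmxP. Qed.

Lemma psdmx1 (R : realType) n : psdmx (1%:M : 'M[R]_n).
Proof.
by split=> [|x]; [apply/symmxP; exact: trmx1 | exact: bform_sqr_ge0].
Qed.

Lemma pdmx1 (R : realType) n : pdmx (1%:M : 'M[R]_n).
Proof.
split=> [|x x0]; first by apply/symmxP; exact: trmx1.
rewrite -/(bform _ _ _) -diag_const_mx.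
by apply: bform_diag_gt0 => // i; rewrite mxE.
Qed.

Lemma loewner_le_refl (R : realType) n (X : 'M[R]_n) : loewner_le X X.
Proof.
rewrite /loewner_le subrr; split=> [|x]; first by apply/symmxP; exact: trmx0.
by rewrite mulmx0 mul0mx mxE.
Qed.

Lemma ord2P (P : 'I_2 -> Prop) : P ord0 -> P ord_max -> forall j, P j.
Proof.
move=> P0 P1 j; have : (j < 2)%N by [].
by case: j => -[|[|//]] j /= _; [move: P0|move: P1]; congr P; apply: val_inj.
Qed.

Section PowerSets.
Variables (R : realType) (q s : nat).
Hypotheses (q0 : (0 < q)%N) (sq : (s <= q)%N).

Let i1 g' : 'I_(2 + g').+1 := ord0.
Let iX g' : 'I_(2 + g').+1 := lift ord0 (lshift g' ord0).
Let iY g' : 'I_(2 + g').+1 := lift ord0 (lshift g' ord_max).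
Let iW g' (r : 'I_g') : 'I_(2 + g').+1 := lift ord0 (rshift 2 r).

(** The constraints are [X >= 0], [Y >= 0], the chain, and [Y <= W_s]. *)
Lemma pow_hypograph_sdr : has_free_sdr (pow_hypograph (s%:R / q%:R : R)).
Proof.
have L := free_lmi_and (free_lmi_and
  (free_lmi_psd R (iX q.+1)) (free_lmi_psd R (iY q.+1)))
  (free_lmi_and (free_lmi_mean_chain R (i1 _) (iX _) (@iW q.+1))
    (free_lmi_le R (iY _) (iW (inord s)))).
pose P n (X : 'I_2 -> 'M[R]_n.+1) := [/\ psdmx (X ord0), psdmx (X ord_max) &
  loewner_le (X ord_max) (powmx (X ord0) (s%:R / q%:R))].
apply: (@has_free_sdr_of_lmi _ _ _ P _ L) => n.
  exists (fun=> 1%:M); rewrite /P powmx1.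
  by split; [exact: psdmx1|exact: psdmx1|exact: loewner_le_refl].
move=> X; rewrite /P; split=> [[X0 Y0 XY]|[sX [W [sW]]]].
  split; first by apply: ord2P; [case: X0|case: Y0].
  exists (fun r : 'I_q.+1 => powmx (X ord0) (r%:R / q%:R)).
  split; first by move=> r; apply/symmxP; exact: powmx_sym.
  rewrite pencil_atoms_chain !pencil_atomsX !pencil_atomsW pencil_atoms1.
  split=> //; split; first exact: mean_chain_powmx.
  by rewrite inordK //; apply/form_leP; rewrite ?powmx_sym ?sym_psdmx.
rewrite pencil_atoms_chain !pencil_atomsX !pencil_atomsW pencil_atoms1.
move=> [[X0 Y0] [ch YW]].
split=> //; apply/form_leP; rewrite ?powmx_sym ?sym_psdmx //.
apply: form_le_trans YW _.
have /(_ (inord s)) := mean_chain_le_powmx X0 q0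
  (fun r => elimT (symmxP _) (sW r)) ch.
by rewrite inordK.
Qed.

(** The constraints are [X >= 0], [Y >= 0], the chain, and
    [[Y, X], [X, W_s]] >= 0. *)
Lemma pow_epigraph_sdr : has_free_sdr (pow_epigraph (2 - s%:R / q%:R : R)).
Proof.
have L := free_lmi_and (free_lmi_and
  (free_lmi_psd R (iX q.+1)) (free_lmi_psd R (iY q.+1)))
  (free_lmi_and (free_lmi_mean_chain R (i1 _) (iX _) (@iW q.+1))
    (free_lmi_block R (iY _) (iX _) (iW (inord s)))).
pose P n (X : 'I_2 -> 'M[R]_n.+1) := [/\ psdmx (X ord0), psdmx (X ord_max) &
  loewner_le (powmx (X ord0) (2 - s%:R / q%:R)) (X ord_max)].
apply: (@has_free_sdr_of_lmi _ _ _ P _ L) => n.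
  exists (fun=> 1%:M); rewrite /P powmx1.
  by split; [exact: psdmx1|exact: psdmx1|exact: loewner_le_refl].
move=> X; rewrite /P; split=> [[X0 Y0 XY]|[sX [W [sW]]]].
  split; first by apply: ord2P; [case: X0|case: Y0].
  exists (fun r : 'I_q.+1 => powmx (X ord0) (r%:R / q%:R)).
  split; first by move=> r; apply/symmxP; exact: powmx_sym.
  rewrite pencil_atoms_chain !pencil_atomsX !pencil_atomsW pencil_atoms1.
  split=> //; split; first exact: mean_chain_powmx.
  rewrite inordK // powmx_le_block_subn //.
  by apply/form_leP; rewrite ?powmx_sym ?sym_psdmx.
rewrite pencil_atoms_chain !pencil_atomsX !pencil_atomsW pencil_atoms1.
move=> [[X0 Y0] [ch YXW]].
split=> //; apply/form_leP; rewrite ?powmx_sym ?sym_psdmx //.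
apply/powmx_le_block_subn => //.
apply: (psd_block_mono (fun=> lexx _) _ YXW).
have /(_ (inord s)) := mean_chain_le_powmx X0 q0
  (fun r => elimT (symmxP _) (sW r)) ch.
by rewrite inordK.
Qed.

(** The auxiliary matrix of index 0 is the witness [V] of [X > 0]; the chain
    occupies the other indices. The constraints are [[V, I], [I, X]] >= 0,
    [Y >= 0], the chain, and [[Y, I], [I, W_s]] >= 0. *)
Lemma pow_epigraph_pd_sdr :
  has_free_sdr (pow_epigraph_pd (- (s%:R / q%:R) : R)).
Proof.
have L := free_lmi_and (free_lmi_and
  (free_lmi_block R (iW (ord0 : 'I_q.+2)) (i1 _) (iX q.+2))
  (free_lmi_psd R (iY q.+2)))
  (free_lmi_and
    (free_lmi_mean_chain R (i1 _) (iX _) (fun r : 'I_q.+1 => iW (lift ord0 r)))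
    (free_lmi_block R (iY _) (i1 _) (iW (lift ord0 (inord s))))).
pose P n (X : 'I_2 -> 'M[R]_n.+1) := [/\ pdmx (X ord0), psdmx (X ord_max) &
  loewner_le (powmx (X ord0) (- (s%:R / q%:R))) (X ord_max)].
apply: (@has_free_sdr_of_lmi _ _ _ P _ L) => n.
  exists (fun=> 1%:M); rewrite /P powmx1.
  split; [exact: pdmx1|exact: psdmx1|exact: loewner_le_refl].
move=> X; rewrite /P; split=> [[X0 Y0 XY]|[sX [W [sW]]]].
  have X0' := pdmx_psd X0.
  split; first by apply: ord2P; [case: X0|case: Y0].
  have [V [sV VX]] := (pdmxE (sym_psdmx X0')).1 X0.
  exists (fun k : 'I_q.+2 => if unlift ord0 k is Some r
    then powmx (X ord0) ((r : nat)%:R / q%:R) else V).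
  split.
    by move=> k; case: unlift => [r|]; apply/symmxP => //; exact: powmx_sym.
  rewrite pencil_atoms_chain !pencil_atomsX !pencil_atomsW pencil_atoms1.
  rewrite unlift_none liftK; split=> //; split.
    by under eq_fun do rewrite liftK; exact: mean_chain_powmx.
  rewrite inordK // powmx_le_block_oppn //.
  by apply/form_leP; rewrite ?powmx_sym ?sym_psdmx.
rewrite pencil_atoms_chain !pencil_atomsX !pencil_atomsW pencil_atoms1.
move=> [[VX Y0] [ch YXW]].
have X0 : pdmx (X ord0).
  by apply/pdmxE; [exact/symmxP | exists (W ord0); split=> //; exact/symmxP].
split=> //; apply/form_leP; rewrite ?powmx_sym ?sym_psdmx //.
apply/powmx_le_block_oppn => //.
apply: (psd_block_mono (fun=> lexx _) _ YXW).
have /(_ (inord s)) := mean_chain_le_powmx (pdmx_psd X0) q0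
  (fun r => elimT (symmxP _) (sW (lift ord0 r))) ch.
by rewrite inordK.
Qed.

End PowerSets.

Theorem theorem1p2 (R : realType) (p : rat) :
  [/\ (0 <= p <= 1 -> has_free_sdr (pow_hypograph (ratr p : R))),
      (1 <= p <= 2 -> has_free_sdr (pow_epigraph (ratr p : R))) &
      (-1 <= p <= 0 -> has_free_sdr (pow_epigraph_pd (ratr p : R)))].
Proof.
split=> p01.
- have [q [s [q0 sq ->]]] := rat_unit_frac R p01.
  exact: pow_hypograph_sdr.
- have p01' : 0 <= 2 - p <= 1 by move: p01; lra.
  have [q [s [q0 sq pE]]] := rat_unit_frac R p01'.
  have -> : ratr p = 2 - s%:R / q%:R :> R.
    by rewrite -pE rmorphB /= ratr_nat; ring.
  exact: pow_epigraph_sdr.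
- have p01' : 0 <= - p <= 1 by move: p01; lra.
  have [q [s [q0 sq pE]]] := rat_unit_frac R p01'.
  have -> : ratr p = - (s%:R / q%:R) :> R by rewrite -pE rmorphN opprK.
  exact: pow_epigraph_pd_sdr.
Qed.
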